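(* Let $K$ be a perfectoid field and $n\ge1$. An element $f=\sum_\alpha f_\alpha X^\alpha\in(T_n^{\mathrm{perf}})^\circ=K^\circ\langle X_1^{1/p^\infty},\dots,X_n^{1/p^\infty}\rangle$ is a unit of $(T_n^{\mathrm{perf}})^\circ$ if and only if $|f_0|=1$ and $|f_\alpha|<1$ for all $\alpha\neq0$.
   Context: $K$ is a perfectoid field of residue characteristic $p$ with valuation ring $K^\circ$. The perfectoid Tate algebra $T_n^{\mathrm{perf}}=K\langle X_1^{1/p^\infty},\dots,X_n^{1/p^\infty}\rangle$ is the completion, for the Gauss norm, of $\bigcup_m K\langle X_1^{1/p^m},\dots,X_n^{1/p^m}\rangle$, i.e. the ring of formal series $\sum_{\alpha\in(\mathbb{Z}[1/p]_{\ge0})^n}f_\alpha X^\alpha$, $f_\alpha\in K$, such that for every real $\lambda>0$ only finitely many $|f_\alpha|\ge\lambda$. $(T_n^{\mathrm{perf}})^\circ$ is its subring of power-bounded elements, consisting of the series with all coefficients in $K^\circ$. *)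

(* Defs.v *)
From HB Require Import structures.
From mathcomp Require Import all_boot all_order all_algebra finmap.
From mathcomp Require Import boolp classical_sets functions cardinality reals.

Set Implicit Arguments.
Unset Strict Implicit.
Unset Printing Implicit Defensive.
Import Order.TTheory GRing.Theory Num.Theory.
Local Open Scope classical_set_scope.
Local Open Scope ring_scope.

(* The rank-one valuation is written multiplicatively, with values in R. *)
HB.mixin Record isCompleteNonarch (R : realType) K of GRing.Field K := {
  vabs : K -> R;
  vabs_ge0 : forall x, 0 <= vabs x;
  vabs_eq0 : forall x, (vabs x == 0) = (x == 0);
  vabsM : forall x y, vabs (x * y) = vabs x * vabs y;
  vabsD_max : forall x y, vabs (x + y) <= Num.max (vabs x) (vabs y);
  vabs_complete : forall u : nat -> K,
    (forall e, 0 < e -> exists N, forall i j,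
       (N <= i)%N -> (N <= j)%N -> vabs (u i - u j) < e) ->
    exists l, forall e, 0 < e -> exists N, forall i,
       (N <= i)%N -> vabs (u i - l) < e
}.

#[short(type="completeNonarchFieldType")]
HB.structure Definition CompleteNonarchField (R : realType) :=
  {K of isCompleteNonarch R K & GRing.Field K}.

(* The residue field has characteristic p when p lies in the maximal ideal
   [vabs x < 1]; the value group is nondiscrete when 1 is not isolated in it;
   the last axiom is the surjectivity of Frobenius on [vabs x <= 1] mod p. *)
HB.mixin Record isPerfectoid (R : realType) (p : nat) K
    of CompleteNonarchField R K := {
  residue_char_prime : prime p;
  residue_char_lt1 : vabs (p%:R : K) < 1;
  vabs_nondiscrete : forall e : R, 0 < e ->
    exists x : K, 1 < vabs x < 1 + e;
  frobenius_surj : forall x : K, vabs x <= 1 ->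
    exists y z : K, [/\ vabs y <= 1, vabs z <= 1 & x = y ^+ p + p%:R * z]
}.

#[short(type="perfectoidFieldType")]
HB.structure Definition PerfectoidField (R : realType) (p : nat) :=
  {K of isPerfectoid R p K & CompleteNonarchField R K}.

Definition zinvp_pred (p : nat) : {pred rat} :=
  fun x => (0 <= x) && p.-nat `|denq x|%N.
Definition zinvp_qual p := [qualify a x | zinvp_pred p x].

Lemma zinvp_closed p : addr_closed (zinvp_qual p).
Proof.
split=> [|x y]; first by rewrite unfold_in.
rewrite !unfold_in => /andP[x0 dx] /andP[y0 dy].
rewrite /zinvp_pred addr_ge0 //=.
have -> : x + y = (numq x * denq y + numq y * denq x)%:Q / (denq x * denq y)%:Q.
  rewrite -{1}(divq_num_den x) -{1}(divq_num_den y).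
  by rewrite addf_div ?intr_eq0 ?denq_neq0 // !rmorphD !rmorphM.
have d0 := mulf_neq0 (denq_neq0 x) (denq_neq0 y).
have : p.-nat (absz (denq x * denq y)) by rewrite abszM pnatM dx dy.
case: divqP d0 => [_|k z k0 _]; first by rewrite eqxx.
by rewrite abszM pnatM => /andP[].
Qed.

(* The nonnegative elements of Z[1/p], as rationals whose reduced denominator
   is a power of p. *)
Record zinvp (p : nat) :=
  Zinvp { zinvp_val :> rat; _ : zinvp_val \is a zinvp_qual p }.
HB.instance Definition _ p := [isSub for @zinvp_val p].
HB.instance Definition _ p := [Choice of zinvp p by <:].
HB.instance Definition _ p :=
  GRing.SubChoice_isSubNmodule.Build rat _ (zinvp p) (zinvp_closed p).

Definition expo (p n : nat) : nmodType := {ffun 'I_n -> zinvp p}.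

Section Sums.
Context {R : realType} {K : completeNonarchFieldType R}.
Implicit Types x y : K.

Definition null_family {I : choiceType} (u : I -> K) : Prop :=
  forall e : R, 0 < e -> finite_set [set i | e <= vabs (u i)].

Definition has_sum {I : choiceType} (u : I -> K) (s : K) : Prop :=
  forall e : R, 0 < e -> exists A : {fset I}, forall B : {fset I},
    (A `<=` B)%fset -> vabs (\sum_(i <- B) u i - s) < e.

(* Meaningful for summable families only, e.g. null ones (null_has_sum). *)
Definition asum {I : choiceType} (u : I -> K) : K := xget 0 (has_sum u).

Lemma vabs0 : vabs (0 : K) = 0.
Proof. by apply/eqP; rewrite vabs_eq0. Qed.

Lemma vabs1 : vabs (1 : K) = 1.
Proof.
have h : vabs (1 : K) != 0 by rewrite vabs_eq0 oner_eq0.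
by apply: (mulfI h); rewrite -vabsM !mulr1.
Qed.

Lemma vabsN x : vabs (- x) = vabs x.
Proof.
have h : vabs (- 1 : K) ^+ 2 = 1 by rewrite expr2 -vabsM mulrNN mulr1 vabs1.
have {}h : vabs (- 1 : K) = 1.
  by apply/eqP; rewrite -(@pexpr_eq1 _ _ 2) ?vabs_ge0 // h.
by rewrite -mulN1r vabsM h mul1r.
Qed.

Lemma vabs_subC x y : vabs (x - y) = vabs (y - x).
Proof. by rewrite -vabsN opprB. Qed.

Lemma vabsD_le x y c : vabs x <= c -> vabs y <= c -> vabs (x + y) <= c.
Proof. by move=> xc yc; apply: le_trans (vabsD_max _ _) _; rewrite ge_max xc. Qed.

Lemma vabsB_le x y z c :
  vabs (x - y) <= c -> vabs (y - z) <= c -> vabs (x - z) <= c.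
Proof. by move=> xy yz; rewrite -(subrK y x) -addrA; apply: vabsD_le. Qed.

Lemma vabs_sum_le (I : eqType) (s : seq I) (P : pred I) (u : I -> K) c :
  0 <= c -> (forall i, i \in s -> P i -> vabs (u i) <= c) ->
  vabs (\sum_(i <- s | P i) u i) <= c.
Proof.
move=> c0 h; rewrite big_seq_cond.
by apply: (big_ind (fun x => vabs x <= c)) => [|x y|i /andP[/h]//];
  [rewrite vabs0|exact: vabsD_le].
Qed.

Lemma vabs_sub_eq x y : (forall e : R, 0 < e -> vabs (x - y) <= e) -> x = y.
Proof.
move=> h; apply/eqP; rewrite -subr_eq0 -(@vabs_eq0 R) eq_le vabs_ge0 andbT.
by apply/ler_addgt0Pl => e /h; rewrite addr0.
Qed.

Section OneFamily.
Variable I : choiceType.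
Implicit Types (u v : I -> K) (A B : {fset I}).

Lemma big_fset_subB u A B : (A `<=` B)%fset ->
  \sum_(i <- B) u i - \sum_(i <- A) u i = \sum_(i <- B | i \notin A) u i.
Proof.
move=> AB; rewrite (bigID (mem A)) /= [X in X + _ - _](_ : _ = \sum_(i <- A) u i).
  by rewrite addrC addKr.
rewrite big_mkcond /= -(big_fset_incl _ AB) => [|i _ /negPf -> //].
by rewrite !big_seq; apply: eq_bigr => i ->.
Qed.

Lemma null_fset u e : null_family u -> 0 < e ->
  exists A, forall i, i \notin A -> vabs (u i) < e.
Proof.
move=> nu e0; exists (fset_set [set i | e <= vabs (u i)]) => i.
by rewrite in_fset_set; [rewrite notin_setE /= => /negP; rewrite -ltNge|exact: nu].
Qed.

Lemma null_bounded u : null_family u ->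
  exists2 M : R, 0 < M & forall i, vabs (u i) <= M.
Proof.
move=> /null_fset/(_ ltr01)[A hA].
have S0 : 0 <= \sum_(i <- A) vabs (u i) by apply: sumr_ge0 => i _; exact: vabs_ge0.
exists (1 + \sum_(i <- A) vabs (u i)); first exact: ltr_pwDl.
move=> i; have [iA|/hA/ltW/le_trans->//] := boolP (i \in A); last by rewrite lerDl.
rewrite (big_fsetD1 i) //= addrCA lerDl addr_ge0 //.
by apply: sumr_ge0 => j _; exact: vabs_ge0.
Qed.

Lemma null_family_le u v : (forall i, vabs (u i) <= vabs (v i)) ->
  null_family v -> null_family u.
Proof.
move=> uv nv e e0; apply: sub_finite_set (nv e e0) => i /= /le_trans; exact.
Qed.

Lemma null_familyD u v : null_family u -> null_family v ->
  null_family (fun i => u i + v i).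
Proof.
move=> nu nv e e0.
apply: (@sub_finite_set _ _
  ([set i | e <= vabs (u i)] `|` [set i | e <= vabs (v i)])).
  move=> i /= h; have := le_trans h (vabsD_max _ _).
  by rewrite le_max => /orP[]; [left|right].
by rewrite finite_setU; split; [exact: nu|exact: nv].
Qed.

Lemma null_familyMr u c : null_family u -> null_family (fun i => u i * c).
Proof.
move=> nu e e0; have [->|c0] := eqVneq c 0.
  apply: (@sub_finite_set _ _ set0) => // i /=.
  by rewrite mulr0 vabs0 leNgt e0.
have vc0 : 0 < vabs c by rewrite lt_neqAle vabs_ge0 eq_sym vabs_eq0 c0.
apply: sub_finite_set (nu (e / vabs c) (divr_gt0 e0 vc0)) => i /=.
by rewrite vabsM ler_pdivrMr.
Qed.

Lemma big_fset_close u A B e : 0 <= e -> (forall i, i \notin A -> vabs (u i) <= e) ->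
  (A `<=` B)%fset -> vabs (\sum_(i <- B) u i - \sum_(i <- A) u i) <= e.
Proof.
move=> e0 uA AB; rewrite big_fset_subB //.
by apply: vabs_sum_le => // i _ /uA.
Qed.

Lemma invS_lt (e : R) : 0 < e -> exists N, forall k, (N <= k)%N -> k.+1%:R^-1 < e.
Proof.
move=> e0; exists (Num.truncn e^-1) => k Nk.
rewrite invf_plt ?posrE ?ltr0Sn //; apply: lt_le_trans (truncnS_gt _) _.
by rewrite ler_nat.
Qed.

Lemma null_has_sum u : null_family u -> exists s, has_sum u s.
Proof.
move=> nu; pose a k : R := k.+1%:R^-1.
have a0 k : 0 < a k by rewrite invr_gt0 ltr0Sn.
pose A k := fset_set [set i | a k <= vabs (u i)].
have uA k i : i \notin A k -> vabs (u i) <= a k.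
  rewrite in_fset_set; last exact: nu.
  by rewrite notin_setE /= => /negP; rewrite -ltNge => /ltW.
have AA i j : (i <= j)%N -> (A i `<=` A j)%fset.
  move=> ij; rewrite -fset_set_sub; [|exact: nu|exact: nu].
  move=> x /=; apply: le_trans.
  by rewrite lef_pV2 ?posrE ?ltr0Sn // ler_nat.
pose S k := \sum_(i <- A k) u i.
have cl k B : (A k `<=` B)%fset -> vabs (\sum_(i <- B) u i - S k) <= a k.
  exact/big_fset_close/uA/ltW.
have [|s hs] := @vabs_complete R K S.
  move=> e /invS_lt[N hN]; exists N => i j Ni Nj.
  apply: le_lt_trans (hN _ (leqnn N)).
  by apply: (@vabsB_le _ (S N)); [|rewrite vabs_subC]; apply/cl/AA.
exists s => e e0; have [N hN] := invS_lt e0; have [M hM] := hs e e0.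
exists (A (maxn N M)) => B /cl h.
rewrite -(subrK (S (maxn N M)) (\sum_(i <- B) u i)) -addrA.
apply: le_lt_trans (vabsD_max _ _) _; rewrite gt_max hM ?leq_maxr // andbT.
by apply: le_lt_trans h _; apply: hN; rewrite leq_maxl.
Qed.

Lemma asum_approx u A e : null_family u -> 0 < e ->
  (forall i, i \notin A -> vabs (u i) <= e) ->
  vabs (asum u - \sum_(i <- A) u i) <= e.
Proof.
move=> /null_has_sum/xgetPex h e0 uA.
have {h} [B hB] : exists B : {fset I}, forall C : {fset I}, (B `<=` C)%fset ->
    vabs (\sum_(i <- C) u i - asum u) < e by exact: h.
apply: (@vabsB_le _ (\sum_(i <- (A `|` B)%fset) u i)).
  by rewrite vabs_subC ltW // hB // fsubsetUr.
by apply: big_fset_close (ltW e0) uA _; exact: fsubsetUl.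
Qed.

Lemma asum_le u e : null_family u -> 0 < e -> (forall i, vabs (u i) <= e) ->
  vabs (asum u) <= e.
Proof.
move=> nu e0 ue; have := @asum_approx u fset0 e nu e0 (fun i _ => ue i).
by rewrite big_seq_fset0 subr0.
Qed.

Lemma eq_asum u v : u =1 v -> asum u = asum v.
Proof. by move=> /funext->. Qed.

Lemma asum_single u i0 : (forall i, i != i0 -> u i = 0) -> asum u = u i0.
Proof.
move=> u0.
have h i : i \notin [fset i0]%fset -> u i = 0 by rewrite inE => /u0.
have nu : null_family u.
  move=> e e0; apply: (@sub_finite_set _ _ [set i0]) => // i /= ui.
  by apply/eqP; apply: contraT => /u0 E; move: ui; rewrite E vabs0 leNgt e0.
apply: vabs_sub_eq => e e0.
have -> : u i0 = \sum_(i <- [fset i0]%fset) u i by rewrite big_seq_fset1.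
apply: asum_approx => // i /h ->.
by rewrite vabs0 ltW.
Qed.

Lemma asumD u v : null_family u -> null_family v ->
  asum (fun i => u i + v i) = asum u + asum v.
Proof.
move=> nu nv; apply: vabs_sub_eq => e e0.
have [A hA] := null_fset nu e0; have [B hB] := null_fset nv e0.
have uh i : i \notin (A `|` B)%fset -> vabs (u i) <= e.
  by rewrite inE negb_or => /andP[/hA/ltW].
have vh i : i \notin (A `|` B)%fset -> vabs (v i) <= e.
  by rewrite inE negb_or => /andP[_ /hB/ltW].
apply: (@vabsB_le _ (\sum_(i <- (A `|` B)%fset) (u i + v i))).
  apply: asum_approx => //; first exact: null_familyD.
  by move=> i h; apply: vabsD_le; [exact: uh|exact: vh].
rewrite big_split /= vabs_subC opprD addrACA.
by apply: vabsD_le; apply: asum_approx.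
Qed.

Lemma asumMr u c : null_family u -> asum (fun i => u i * c) = asum u * c.
Proof.
move=> nu; apply: vabs_sub_eq => e e0.
have [A hA] := null_fset nu e0.
have [->|c0] := eqVneq c 0.
  rewrite mulr0 subr0; apply: asum_le => [|//|i]; last by rewrite mulr0 vabs0 ltW.
  exact: null_familyMr.
have vc0 : 0 < vabs c by rewrite lt_neqAle vabs_ge0 eq_sym vabs_eq0 c0.
have [C hC] := null_fset nu (divr_gt0 e0 vc0).
have h i : i \notin C -> vabs (u i * c) <= e.
  by move=> /hC/ltW; rewrite vabsM ler_pdivlMr.
apply: (@vabsB_le _ (\sum_(i <- C) u i * c)).
  by apply: asum_approx => //; exact: null_familyMr.
rewrite -mulr_suml -mulrBl vabsM -ler_pdivlMr // vabs_subC.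
by apply: asum_approx => [//||i /hC/ltW //]; exact: divr_gt0.
Qed.

End OneFamily.

Section TwoFamilies.
Variables I J : choiceType.

Lemma null_reindex (f : I -> J) (u : J -> K) :
  (forall j, ~ range f j -> u j = 0) ->
  null_family (u \o f) -> null_family u.
Proof.
move=> u0 nf e e0.
apply: (@sub_finite_set _ _ (f @` [set i | e <= vabs (u (f i))])).
  move=> j /= uj; have [[i _ fi]|/u0 E] := pselect (range f j).
    by exists i => //=; rewrite fi.
  by move: uj; rewrite E vabs0 leNgt e0.
exact/finite_image/nf.
Qed.

Lemma asum_reindex (f : I -> J) (u : J -> K) : injective f ->
  (forall j, ~ range f j -> u j = 0) -> null_family (u \o f) ->
  asum u = asum (u \o f).
Proof.
move=> fI u0 nf; have nu := null_reindex u0 nf.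
apply: vabs_sub_eq => e e0; have [A hA] := null_fset nf e0.
apply: (@vabsB_le _ (\sum_(j <- (f @` A)%fset) u j)).
  apply: asum_approx => // j jA.
  have [[i _ fi]|/u0 ->] := pselect (range f j); last by rewrite vabs0 ltW.
  rewrite -fi ltW // hA //; apply: contra jA => iA; rewrite -fi.
  exact: in_imfset.
rewrite big_imfset /=; last by move=> x y _ _; exact: fI.
by rewrite vabs_subC; apply: asum_approx => // i /hA/ltW.
Qed.

Lemma null_familyM (u : I -> K) (v : J -> K) : null_family u -> null_family v ->
  null_family (fun ij : I * J => u ij.1 * v ij.2).
Proof.
move=> nu nv e e0.
have [M M0 hM] := null_bounded nu; have [N N0 hN] := null_bounded nv.
apply: (@sub_finite_set _ _
  ([set i | e / N <= vabs (u i)] `*` [set j | e / M <= vabs (v j)])).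
  move=> [i j] /=; rewrite vabsM => h.
  rewrite !ler_pdivrMr //; split; apply: le_trans h _.
    by apply: ler_wpM2l; rewrite ?vabs_ge0.
  by rewrite mulrC; apply: ler_wpM2l; rewrite ?vabs_ge0.
by apply: finite_setX; [apply: nu|apply: nv]; exact: divr_gt0.
Qed.

Lemma asum_fubini (u : I * J -> K) : null_family u ->
  asum (fun i => asum (fun j => u (i, j))) = asum u.
Proof.
move=> nu.
have nuj i : null_family (fun j => u (i, j)).
  move=> e e0; apply: (@sub_finite_set _ _ (snd @` [set ij | e <= vabs (u ij)])).
    by move=> j /= h; exists (i, j).
  exact/finite_image/nu.
have small e : 0 < e -> exists A : {fset I}, exists B : {fset J},
    forall i j, ~~ ((i \in A) && (j \in B)) -> vabs (u (i, j)) <= e.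
  move=> e0; have [C hC] := null_fset nu e0.
  exists [fset ij.1 | ij in C]%fset, [fset ij.2 | ij in C]%fset => i j h.
  rewrite ltW // hC //; apply: contra h => ijC.
  by apply/andP; split; apply/imfsetP; exists (i, j).
have nG : null_family (fun i => asum (fun j => u (i, j))).
  move=> e e0; have e20 : 0 < e / 2 by rewrite divr_gt0.
  have [A [B h]] := small _ e20.
  apply: (@sub_finite_set _ _ [set` A]); last exact: finite_fset.
  move=> i /= ei; apply: contraT => iA; move: ei; rewrite leNgt => /negP[].
  apply: (@le_lt_trans _ _ (e / 2)); last by rewrite ltr_pdivrMr // ltr_pMr // ltr1n.
  by apply: asum_le => // j; apply: h; rewrite (negPf iA).
apply: vabs_sub_eq => e e0; have [A [B h]] := small _ e0.
apply: (@vabsB_le _ (\sum_(i <- A) asum (fun j => u (i, j)))).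
  apply: asum_approx => // i iA; apply: asum_le => // j.
  by apply: h; rewrite (negPf iA).
apply: (@vabsB_le _ (\sum_(i <- A) \sum_(j <- B) u (i, j))).
  rewrite -sumrB; apply: vabs_sum_le => [|i _ _]; first exact: ltW.
  by apply: asum_approx => // j jB; apply: h; rewrite (negPf jB) andbF.
have -> : \sum_(i <- A) \sum_(j <- B) u (i, j) = \sum_(x <- (A `*` B)%fset) u x.
  rewrite -big_allpairs.
  apply: perm_big; apply: uniq_perm; [|exact: fset_uniq|].
    by apply: allpairs_uniq => //; [exact: fset_uniq..|move=> [? ?] [? ?]].
  move=> [i j]; rewrite in_fsetM /=; apply/allpairsP/andP => /=.
    by move=> [[? ?] /= [? ? [-> ->]]].
  by move=> [? ?]; exists (i, j).
rewrite vabs_subC; apply: asum_approx => // -[i j].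
by rewrite in_fsetM; exact: h.
Qed.

End TwoFamilies.
End Sums.

(* Series sum_a (coef f a) X^a, with only finitely many coefficients of absolute
   value >= e, for every e > 0. *)
Record tate_perf (R : realType) (p n : nat) (K : completeNonarchFieldType R) :=
  TatePerf { coef :> expo p n -> K; coef_null : null_family coef }.
Arguments tate_perf {R} p n K.

Section TatePerf.
Context {R : realType} (p n : nat) {K : completeNonarchFieldType R}.
Notation E := (expo p n).
Notation T := (tate_perf p n K).
Implicit Types (f g h : T) (a b c d : E).

HB.instance Definition _ := gen_eqMixin T.
HB.instance Definition _ := gen_choiceMixin T.

Lemma tate_perfP f g : coef f =1 coef g -> f = g.
Proof.
case: f g => [f nf] [g ng] /= /funext fg; case: _ / fg in ng *.
by congr TatePerf; exact: Prop_irrelevance.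
Qed.

Lemma tp_zero_null : null_family (fun _ : E => 0 : K).
Proof.
move=> e e0; apply: (@sub_finite_set _ _ set0) => // i /=.
by rewrite vabs0 leNgt e0.
Qed.
Definition tp_zero : T := TatePerf tp_zero_null.

Lemma tp_opp_null f : null_family (fun a => - f a).
Proof.
by apply: null_family_le (coef_null f) => a; rewrite vabsN.
Qed.
Definition tp_opp f : T := TatePerf (tp_opp_null f).

Definition tp_add f g : T :=
  TatePerf (null_familyD (coef_null f) (coef_null g)).

Definition tp_one_coef a : K := (a == 0)%:R.
Lemma tp_one_null : null_family tp_one_coef.
Proof.
move=> e e0; apply: (@sub_finite_set _ _ [set 0]) => // i /=.
by rewrite /tp_one_coef; case: eqP => // _; rewrite vabs0 leNgt e0.
Qed.
Definition tp_one : T := TatePerf tp_one_null.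

(* In general infinitely many pairs (a, b) satisfy a + b = d, so the coefficient
   of X^d in f * g is an infinite sum in K. *)
Definition tp_mul_term f g d (ab : E * E) : K :=
  if ab.1 + ab.2 == d then f ab.1 * g ab.2 else 0.
Definition tp_mul_coef f g d : K := asum (tp_mul_term f g d).

Lemma tp_mul_term_null f g d : null_family (tp_mul_term f g d).
Proof.
apply: null_family_le (null_familyM (coef_null f) (coef_null g)) => ab.
by rewrite /tp_mul_term; case: ifP => // _; rewrite vabs0 vabs_ge0.
Qed.

Lemma tp_mul_null f g : null_family (tp_mul_coef f g).
Proof.
move=> e e0; have e20 : 0 < e / 2 by rewrite divr_gt0.
have nfg := null_familyM (coef_null f) (coef_null g).
apply: (@sub_finite_set _ _ ((fun ab : E * E => ab.1 + ab.2) @`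
    [set ab | e / 2 <= vabs (f ab.1 * g ab.2)])); last exact/finite_image/nfg.
move=> d /= ed; apply: contra_leP ed => nd.
apply: (@le_lt_trans _ _ (e / 2)); last by rewrite ltr_pdivrMr // ltr_pMr // ltr1n.
apply: asum_le => [|//|ab]; first exact: tp_mul_term_null.
rewrite /tp_mul_term; case: eqP => [abd|_]; last by rewrite vabs0 ltW.
by rewrite leNgt; apply/negP => /ltW h; apply: nd; exists ab.
Qed.
Definition tp_mul f g : T := TatePerf (tp_mul_null f g).

Lemma tp_addA : associative tp_add.
Proof. by move=> f g h; apply: tate_perfP => a; exact: addrA. Qed.
Lemma tp_addC : commutative tp_add.
Proof. by move=> f g; apply: tate_perfP => a; exact: addrC. Qed.
Lemma tp_add0 : left_id tp_zero tp_add.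
Proof. by move=> f; apply: tate_perfP => a; exact: add0r. Qed.
Lemma tp_addN : left_inverse tp_zero tp_opp tp_add.
Proof. by move=> f; apply: tate_perfP => a; exact: addNr. Qed.

HB.instance Definition _ :=
  GRing.isZmodule.Build T tp_addA tp_addC tp_add0 tp_addN.

Lemma tp_mulC : commutative tp_mul.
Proof.
move=> f g; apply: tate_perfP => d /=; rewrite /tp_mul_coef.
pose s (x : E * E) := (x.2, x.1).
have fsg : tp_mul_term f g d \o s = tp_mul_term g f d.
  by apply/funext => -[a b]; rewrite /tp_mul_term /= addrC mulrC.
rewrite (asum_reindex (f := s)) ?fsg //.
- by move=> [? ?] [? ?] [-> ->].
- by move=> [a b] []; exists (b, a).
- exact: tp_mul_term_null.
Qed.

Definition tp_mul3_term f g h d (x : E * E * E) : K :=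
  if x.1.1 + x.1.2 + x.2 == d then f x.1.1 * g x.1.2 * h x.2 else 0.

Lemma tp_mul3_term_null f g h d : null_family (tp_mul3_term f g h d).
Proof.
have n3 := null_familyM (null_familyM (coef_null f) (coef_null g)) (coef_null h).
apply: null_family_le n3 => x.
by rewrite /tp_mul3_term; case: ifP => // _; rewrite vabs0 vabs_ge0.
Qed.

Lemma tp_mul3 f g h d :
  tp_mul_coef (tp_mul f g) h d = asum (tp_mul3_term f g h d).
Proof.
pose F (x : (E * E) * (E * E)) : K :=
  if (x.1.1 + x.1.2 == d) && (x.2.1 + x.2.2 == x.1.1)
  then f x.2.1 * g x.2.2 * h x.1.2 else 0.
pose s (x : E * E * E) : (E * E) * (E * E) := ((x.1.1 + x.1.2, x.2), x.1).
have Fs : F \o s = tp_mul3_term f g h d.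
  by apply/funext => -[[a b] c]; rewrite /F /tp_mul3_term /= eqxx andbT.
have F0 x : ~ range s x -> F x = 0.
  case: x => [[e c] [a b]] ns; rewrite /F /=; case: ifP => // /andP[_ /eqP abe].
  by case: ns; exists (a, b, c); rewrite // /s /= abe.
have nFs : null_family (F \o s) by rewrite Fs; exact: tp_mul3_term_null.
rewrite -Fs -asum_reindex //; last by move=> [[? ?] ?] [[? ?] ?] [_ -> -> ->].
rewrite -asum_fubini; last exact: null_reindex F0 nFs.
apply: eq_asum => -[e c]; rewrite /tp_mul_term /F /=.
case: eqP => _ /=; last by rewrite (@asum_single _ _ _ _ (0, 0)).
rewrite /tp_mul_coef -asumMr; last exact: tp_mul_term_null.
by apply: eq_asum => -[a b]; rewrite /tp_mul_term /=; case: ifP; rewrite ?mul0r.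
Qed.

Lemma tp_mulA : associative tp_mul.
Proof.
move=> f g h; rewrite [LHS]tp_mulC; apply: tate_perfP => d /=; rewrite !tp_mul3.
pose s (x : E * E * E) := (x.1.2, x.2, x.1.1).
have gs : tp_mul3_term g h f d \o s = tp_mul3_term f g h d.
  apply/funext => -[[a b] c]; rewrite /tp_mul3_term /=.
  by rewrite [b + c + a]addrC addrA [g b * h c * f a]mulrC mulrA.
rewrite (asum_reindex (f := s)) ?gs //.
- by move=> [[? ?] ?] [[? ?] ?] [-> -> ->].
- by move=> [[a b] c] []; exists (c, a, b).
- exact: tp_mul3_term_null.
Qed.

Lemma tp_mul1 : left_id tp_one tp_mul.
Proof.
move=> f; apply: tate_perfP => d /=; rewrite /tp_mul_coef.
rewrite (@asum_single _ _ _ _ (0, d)).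
  by rewrite /tp_mul_term /= add0r eqxx /tp_one_coef eqxx mul1r.
move=> [a b]; rewrite /tp_mul_term /= /tp_one_coef xpair_eqE.
case: (eqVneq a 0) => [->|_] /=; last by rewrite mul0r if_same.
by rewrite add0r => /negPf->.
Qed.

Lemma tp_mulD : left_distributive tp_mul tp_add.
Proof.
move=> f g h; apply: tate_perfP => d /=.
rewrite /tp_mul_coef -asumD; [|exact: tp_mul_term_null|exact: tp_mul_term_null].
apply: eq_asum => -[a b]; rewrite /tp_mul_term /=.
by case: ifP; rewrite ?addr0 // mulrDl.
Qed.

Lemma tp_one_neq0 : tp_one != 0.
Proof.
apply/eqP => /(congr1 (fun f : T => f 0)) /=; rewrite /tp_one_coef eqxx.
by apply/eqP; exact: oner_neq0.
Qed.

HB.instance Definition _ := GRing.Zmodule_isComNzRing.Build T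
  tp_mulA tp_mulC tp_mul1 tp_mulD tp_one_neq0.

Definition gauss_norm f : R := sup (range (fun a => vabs (f a))).

Definition power_bounded f : Prop :=
  exists C : R, forall k : nat, gauss_norm (f ^+ k) <= C.

(* The inverse is required to be power-bounded as well: f is a unit of the
   subring, not just of tate_perf. *)
Definition power_bounded_unit f : Prop :=
  power_bounded f /\ exists2 g : T, power_bounded g & f * g = 1.

End TatePerf.

(* Main.v *)
Require Import Defs.
From mathcomp Require Import all_boot all_order all_algebra finmap.
From mathcomp Require Import boolp classical_sets cardinality reals.
From mathcomp Require Import normedtype sequences.
Import Order.TTheory GRing.Theory Num.Theory.
Import numFieldNormedType.Exports.
Local Open Scope ring_scope.

Set Implicit Arguments.
Unset Strict Implicit.
Unset Printing Implicit Defensive.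

(** The power-bounded series are those of Gauss norm at most one, because the
    Gauss norm is multiplicative ([gauss_normM], [power_boundedP]).  This is
    the Gauss lemma: order the exponents lexicographically and call leading the
    last exponent at which a nonzero series attains its norm.  If [a] and [b]
    are leading for [f] and [g], then in the possibly infinite sum that gives
    the coefficient of [f * g] at [a + b] the term [f a * g b] is strictly
    larger than all the others, so by the ultrametric inequality it alone
    decides the absolute value ([vabs_leadingM]).

    Let [f * g = 1] with [f] and [g] power-bounded.  Both norms are at most one
    and their product is one, so [f] has norm one.  The coefficient of
    [f * g = 1] at the sum of the leading exponents is nonzero, so this sum is
    zero; the exponents being nonnegative, the leading exponent of [f] is zero
    ([leading_inverse]).  Since zero is lexicographically first, every other
    coefficient has absolute value less than one.

    Conversely, if the constant coefficient of [f] dominates strictly, then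
    [f], divided by it, is [1 - h] with [h] of Gauss norm less than one, and the
    geometric series of [h] converges to an inverse ([geometric_inverse]).  This
    inverse has norm one by multiplicativity, hence is power-bounded. *)

(** * Powers of a real number *)

Lemma expr_small (R : realType) (x e : R) :
  0 <= x < 1 -> 0 < e -> exists N, forall k, (N <= k)%N -> x ^+ k < e.
Proof.
move=> /andP[x0 x1] e0.
have x_lt1 : `|x| < 1 by rewrite ger0_norm.
have [N _ hN] := (cvgr0Pnorm_lt (GRing.exp x)).1 (cvg_expr x_lt1) e e0.
by exists N => k /hN /=; rewrite ger0_norm // exprn_ge0.
Qed.

Lemma expr_bounded_le1 (R : realType) (x C : R) :
  (forall k, x ^+ k <= C) -> x <= 1.
Proof.
move=> hC; rewrite leNgt; apply/negP => x1.
have x0 : 0 < x by apply: lt_trans x1.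
have C0 : 0 < C by apply: lt_le_trans (hC 0%N); rewrite expr0.
have xV : 0 <= x^-1 < 1 by rewrite invr_ge0 ltW //= invf_lt1.
have [N /(_ N (leqnn N))] : exists N, forall k, (N <= k)%N -> x^-1 ^+ k < C^-1.
  by apply: expr_small; rewrite ?invr_gt0.
by rewrite exprVn ltf_pV2 ?posrE ?exprn_gt0 // ltNge hC.
Qed.

(** * Null families in a nonarchimedean field *)

Section NullFamilies.
Context {R : realType} {K : completeNonarchFieldType R}.
Implicit Types x y : K.

Lemma vabs_gt0 x : (0 < vabs x) = (x != 0).
Proof. by rewrite lt_def vabs_ge0 vabs_eq0 andbT. Qed.

(** The isosceles triangle property. *)
Lemma vabs_dominant x y : vabs (y - x) < vabs x -> vabs y = vabs x.
Proof.
move=> yx; apply/eqP; rewrite eq_le; apply/andP; split.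
  by rewrite -(subrK x y); apply: vabsD_le; [exact: ltW|].
rewrite leNgt; apply/negP => lt_yx.
have := vabsD_max (x - y) y; rewrite subrK leNgt gt_max lt_yx andbT.
by rewrite vabs_subC yx.
Qed.

(** Only finitely many terms exceed [M / 2], so a pointwise strict bound by [M]
    is uniform. *)
Lemma null_family_gap (I : choiceType) (u : I -> K) (P : pred I) (M : R) :
  null_family u -> 0 < M -> (forall i, P i -> vabs (u i) < M) ->
  exists2 e, 0 < e < M & forall i, P i -> vabs (u i) <= e.
Proof.
move=> nu M0 uM; have M20 : 0 < M / 2 by rewrite divr_gt0.
have M2M : M / 2 < M by rewrite ltr_pdivrMr // ltr_pMr // ltr1n.
have [A hA] := null_fset nu M20.
suff [e eM he] : exists2 e, 0 < e < M &
    forall i, i \in enum_fset A -> P i -> vabs (u i) <= e.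
  exists (Num.max e (M / 2)) => [|i Pi].
    by rewrite gt_max lt_max M20 orbT M2M andbT; case/andP: eM.
  rewrite le_max; have [/he->//|/hA/ltW->] := boolP (i \in A).
  by rewrite orbT.
elim: (enum_fset A) => [|j s [e /andP[e0 eM] he]].
  by exists (M / 2); rewrite ?M20.
have [Pj|nPj] := boolP (P j); last first.
  exists e => [|i]; first by rewrite e0.
  by rewrite inE => /predU1P[->|/he//]; rewrite (negPf nPj).
exists (Num.max e (vabs (u j))) => [|i].
  by rewrite gt_max lt_max e0 eM uM.
rewrite inE le_max => /predU1P[->|/he h /h->//].
by rewrite lexx orbT.
Qed.

(** The gap is what carries the isosceles property over to infinite sums: the
    remaining terms add up to at most their common bound [e], not merely to at
    most [vabs (u i0)]. *)
Lemma vabs_asum_dominant (I : choiceType) (u : I -> K) (i0 : I) :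
  null_family u -> u i0 != 0 ->
  (forall i, i != i0 -> vabs (u i) < vabs (u i0)) ->
  vabs (asum u) = vabs (u i0).
Proof.
move=> nu; rewrite -vabs_gt0 => ui0.
move=> /(null_family_gap nu ui0)[e /andP[e0 eM] he].
apply: vabs_dominant; apply: le_lt_trans eM.
have <- : \sum_(i <- [fset i0]%fset) u i = u i0 by rewrite big_seq_fset1.
apply: asum_approx => // i.
by rewrite inE => /he.
Qed.

End NullFamilies.

(** * Lexicographic order on exponents *)

Section Lex.
Variables p n : nat.
Implicit Types a b c : expo p n.

(** Any total order on exponents would do that is compatible with addition and
    has zero as least element. *)
Definition lexlt a b : Prop :=
  exists i : 'I_n, (forall j : 'I_n, (j < i)%N -> a j = b j) /\
            zinvp_val (a i) < zinvp_val (b i).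

Lemma lexlt_irr a : ~ lexlt a a.
Proof. by move=> [i [_]]; rewrite ltxx. Qed.

Lemma lexlt_trans b a c : lexlt a b -> lexlt b c -> lexlt a c.
Proof.
move=> [i [ab_lt ab]] [j [bc_lt bc]].
have [ij|ji|/ord_inj ij] := ltngtP i j.
- exists i; split=> [k ki|]; last by rewrite -(bc_lt _ ij).
  by rewrite ab_lt // bc_lt // (ltn_trans ki).
- exists j; split=> [k kj|]; last by rewrite (ab_lt _ ji).
  by rewrite ab_lt ?bc_lt // (ltn_trans kj).
- subst j; exists i; split=> [k ki|]; last exact: lt_trans bc.
  by rewrite ab_lt ?bc_lt.
Qed.

Lemma lexlt_total a b : [\/ a = b, lexlt a b | lexlt b a].
Proof.
have [->|/eqP neq_ab] := eqVneq a b; first by constructor 1.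
have [i0 abi0] : exists i, a i != b i.
  apply/existsP; apply: contra_notT neq_ab; rewrite negb_exists => /forallP ab.
  by apply/ffunP => i; apply/eqP; have := ab i; rewrite negbK.
case: (@arg_minnP _ i0 (fun i => a i != b i) (@nat_of_ord n) abi0).
move=> i abi i_min.
have eq_lt (j : 'I_n) : (j < i)%N -> a j = b j.
  by move=> ji; apply: contraTeq ji => /i_min /=; rewrite -leqNgt.
have [ab|ba|ab] := ltgtP (zinvp_val (a i)) (zinvp_val (b i)).
- by constructor 2; exists i.
- by constructor 3; exists i; split=> // j /eq_lt.
- by move: abi; rewrite -val_eqE /= ab eqxx.
Qed.

Lemma lexltD2r c a b : lexlt a b -> lexlt (a + c) (b + c).
Proof.
move=> [i [ab_lt ab]]; exists i; split=> [j ji|].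
  by rewrite !ffunE ab_lt.
by rewrite !ffunE /= ltrD2r.
Qed.

Lemma lexlt_gt0 a : a != 0 -> lexlt 0 a.
Proof.
case: (lexlt_total a 0) => [->|[i [_]]|//]; first by rewrite eqxx.
rewrite ffunE /= => ai0 _.
by have := valP (a i); rewrite unfold_in => /andP[]; rewrite leNgt ai0.
Qed.

Lemma lexltD a a' b b' : lexlt a a' -> lexlt b b' -> lexlt (a + b) (a' + b').
Proof.
move=> aa' bb'; apply: (@lexlt_trans (a' + b)); first exact: lexltD2r.
by rewrite ![a' + _]addrC; apply: lexltD2r.
Qed.

(** This is what makes the product of two leading terms a term that nothing can
    cancel. *)
Lemma lexlt_addP a b a' b' : a' + b' = a + b ->
  [\/ (a', b') = (a, b), lexlt a a' | lexlt b b'].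
Proof.
case: (lexlt_total a' a) => [->|a'a|]; last by constructor 2.
  case: (lexlt_total b' b) => [->|b'b|]; [by constructor 1| |by constructor 3].
  move=> E; have := lexltD2r a b'b; rewrite ![_ + a]addrC E.
  by move/lexlt_irr.
case: (lexlt_total b' b) => [->|b'b|]; last by constructor 3.
  by move=> E; have := lexltD2r b a'a; rewrite E => /lexlt_irr.
by move=> E; have := lexltD a'a b'b; rewrite E => /lexlt_irr.
Qed.

Lemma expo_add_eq0 a b : a + b = 0 -> a = 0.
Proof.
move=> ab0; apply/eqP/negP => /negP/lexlt_gt0/(lexltD2r b).
rewrite ab0 add0r; have [->|/lexlt_gt0 b0 /(lexlt_trans b0)] := eqVneq b 0;
  exact: lexlt_irr.
Qed.

End Lex.

(** * The Gauss norm is multiplicative *)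

(** Stated for relations in [Prop], so as to apply to the comparison of
    exponents first by coefficient size and then lexicographically. *)
Lemma seq_maximal (T : eqType) (lt : T -> T -> Prop) (s : seq T) (x : T) :
  (forall y x z, lt x y -> lt y z -> lt x z) ->
  (forall x y, [\/ x = y, lt x y | lt y x]) -> x \in s ->
  exists2 m, m \in s & forall y, y \in s -> y = m \/ lt y m.
Proof.
move=> lt_trans lt_total; elim: s x => // y s IHs x _.
case: s IHs => [_|z s IHs].
  by exists y => [|t]; rewrite inE // => /eqP; left.
have [m ms hm] := IHs z (mem_head z s).
case: (lt_total y m) => [->|ym|my].
- by exists m => [|t]; rewrite inE ?eqxx // => /predU1P[->|/hm//]; left.
- exists m => [|t]; rewrite inE ?ms ?orbT // => /predU1P[->|/hm//]; by right.
- exists y => [|t]; rewrite inE ?eqxx // => /predU1P[->|/hm[->|tm]].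
  + by left.
  + by right.
  + by right; apply: lt_trans my.
Qed.

Section GaussNorm.
Context {R : realType} {p n : nat} {K : completeNonarchFieldType R}.
Notation E := (expo p n).
Notation T := (tate_perf p n K).
Implicit Types (f g h : T) (a b c d : E).

Lemma tpDE f g a : (f + g) a = f a + g a. Proof. by []. Qed.
Lemma tpNE f a : (- f) a = - f a. Proof. by []. Qed.
Lemma tp0E a : (0 : T) a = 0. Proof. by []. Qed.
Lemma tp1E a : (1 : T) a = (a == 0)%:R. Proof. by []. Qed.
Lemma tpME f g a : (f * g) a = asum (tp_mul_term f g a). Proof. by []. Qed.

Lemma tp_sumE (I : Type) (s : seq I) (F : I -> T) a :
  (\sum_(i <- s) F i) a = \sum_(i <- s) F i a.
Proof. by elim/big_rec2: _ => //= i x y _ <-. Qed.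

Lemma gauss_norm_ge f a : vabs (f a) <= gauss_norm f.
Proof.
apply: ub_le_sup; last by exists a.
have [M _ hM] := null_bounded (coef_null f).
by exists M => _ [b _ <-].
Qed.

Lemma gauss_norm_leP f (C : R) :
  gauss_norm f <= C <-> forall a, vabs (f a) <= C.
Proof.
split=> [fC a|fC]; first exact: le_trans (gauss_norm_ge f a) fC.
by apply: ge_sup; [exists (vabs (f 0)), 0|move=> _ [a _ <-]].
Qed.

Lemma gauss_norm_ge0 f : 0 <= gauss_norm f.
Proof. exact: le_trans (vabs_ge0 _) (gauss_norm_ge f 0). Qed.

Lemma gauss_norm_max f a :
  (forall b, vabs (f b) <= vabs (f a)) -> gauss_norm f = vabs (f a).
Proof.
move=> fa; apply/le_anti/andP.
by split; [exact/gauss_norm_leP|exact: gauss_norm_ge].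
Qed.

Lemma gauss_norm0 : gauss_norm (0 : T) = 0.
Proof. by rewrite (@gauss_norm_max 0 0) tp0E vabs0. Qed.

Lemma gauss_norm1 : gauss_norm (1 : T) = 1.
Proof.
rewrite (@gauss_norm_max 1 0) tp1E eqxx vabs1 // => b.
by rewrite tp1E; case: eqP => _; rewrite ?vabs1 ?vabs0.
Qed.

Lemma gauss_normN f : gauss_norm (- f) = gauss_norm f.
Proof. by congr sup; congr image; apply/funext => a; rewrite tpNE vabsN. Qed.

Lemma gauss_normD_le f g (C : R) :
  gauss_norm f <= C -> gauss_norm g <= C -> gauss_norm (f + g) <= C.
Proof.
move=> /gauss_norm_leP fC /gauss_norm_leP gC.
by apply/gauss_norm_leP => a; apply: vabsD_le.
Qed.

Lemma gauss_norm_small f : (forall e, 0 < e -> gauss_norm f <= e) -> f = 0.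
Proof.
move=> fe; apply: tate_perfP => a; apply: vabs_sub_eq => e.
move=> /fe/gauss_norm_leP/(_ a).
by rewrite tp0E subr0.
Qed.

(** The lexicographically last exponent among those, finitely many, at which the
    Gauss norm is attained. *)
Definition leading f a : Prop :=
  [/\ f a != 0, forall b, vabs (f b) <= vabs (f a)
    & forall b, lexlt a b -> vabs (f b) < vabs (f a)].

Lemma leading_exists f : f != 0 -> exists a, leading f a.
Proof.
move=> f0.
have {f0} [c fc0] : exists c, f c != 0.
  apply: contra_notP (elimN eqP f0) => /forallNP fz; apply: tate_perfP => a.
  by have /negP := fz a; rewrite negbK => /eqP.
move: (fc0); rewrite -vabs_gt0 => fc_gt0.
have finA := coef_null f fc_gt0.
pose A := fset_set [set a | vabs (f c) <= vabs (f a)]%classic.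
have memA a : (a \in A) = (vabs (f c) <= vabs (f a)).
  rewrite in_fset_set //; apply/idP/idP; first by rewrite inE.
  by move=> h; rewrite inE.
(* A maximum for this order is leading: ties in absolute value are broken
   lexicographically. *)
pose prec a b :=
  vabs (f a) < vabs (f b) \/ (vabs (f a) = vabs (f b) /\ lexlt a b).
have [|||m mA hm] := @seq_maximal _ prec (enum_fset A) c.
- move=> b a d [ab|[ab lab]] [bd|[bd lbd]]; rewrite /prec.
  + by left; apply: lt_trans bd.
  + by left; rewrite -bd.
  + by left; rewrite ab.
  + by right; split; [rewrite ab|apply: lexlt_trans lbd].
- move=> a b; have [ab|ba|ab] := ltgtP (vabs (f a)) (vabs (f b)).
  + by constructor 2; left.
  + by constructor 3; left.
  + case: (lexlt_total a b) => [->|lab|lba]; first by constructor 1.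
      by constructor 2; right.
    by constructor 3; right.
- by rewrite memA.
have {mA} cm : vabs (f c) <= vabs (f m) by rewrite -memA.
have {hm} m_max b : [\/ b = m, vabs (f b) < vabs (f m)
                | vabs (f b) = vabs (f m) /\ lexlt b m].
  have [/hm[->|[lt_bm|eq_bm]]|] := boolP (b \in A).
  - by constructor 1.
  - by constructor 2.
  - by constructor 3.
  by rewrite memA -ltNge => bc; constructor 2; apply: lt_le_trans cm.
exists m; split=> [|b|b mb]; first by rewrite -vabs_gt0; apply: lt_le_trans cm.
  by case: (m_max b) => [->|/ltW|[->]].
case: (m_max b) => [bm|//|[_ bm]].
  by rewrite bm in mb; case: (lexlt_irr mb).
by case: (lexlt_irr (lexlt_trans mb bm)).
Qed.

Lemma gauss_norm_leading f a : leading f a -> gauss_norm f = vabs (f a).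
Proof. by case=> _ fa _; exact: gauss_norm_max. Qed.

(** Among the pairs of exponents of sum [a + b], the pair [(a, b)] is the only
    one at which both factors reach their norm, so its term dominates. *)
Lemma vabs_leadingM f g a b : leading f a -> leading g b ->
  vabs ((f * g) (a + b)) = vabs (f a) * vabs (g b).
Proof.
move=> [fa0 fle flt] [gb0 gle glt].
have tab : tp_mul_term f g (a + b) (a, b) = f a * g b.
  by rewrite /tp_mul_term eqxx.
rewrite tpME (@vabs_asum_dominant _ _ _ _ (a, b)).
- by rewrite tab vabsM.
- exact: tp_mul_term_null.
- by rewrite tab mulf_neq0.
move=> [a' b'] neq; rewrite tab /tp_mul_term /=.
case: eqP => [E|_]; last by rewrite vabs0 vabs_gt0 mulf_neq0.
rewrite !vabsM; case: (lexlt_addP E) => [[Ea Eb]|/flt lt_f|/glt lt_g].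
- by rewrite Ea Eb eqxx in neq.
- apply: le_lt_trans (_ : _ <= vabs (f a') * vabs (g b)) _.
    by rewrite ler_wpM2l ?vabs_ge0.
  by rewrite ltr_pM2r ?vabs_gt0.
- apply: le_lt_trans (_ : _ <= vabs (f a) * vabs (g b')) _.
    by rewrite ler_wpM2r ?vabs_ge0.
  by rewrite ltr_pM2l ?vabs_gt0.
Qed.

Lemma gauss_normM_le f g : gauss_norm (f * g) <= gauss_norm f * gauss_norm g.
Proof.
have term_le d ab : vabs (tp_mul_term f g d ab) <= gauss_norm f * gauss_norm g.
  rewrite /tp_mul_term; case: ifP => _.
    by rewrite vabsM; apply: ler_pM; rewrite ?vabs_ge0 ?gauss_norm_ge.
  by rewrite vabs0 mulr_ge0 ?gauss_norm_ge0.
(* A positive slack, since the bound on an infinite sum has to be positive. *)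
apply/gauss_norm_leP => d; rewrite tpME; apply/ler_addgt0Pr => e e0.
apply: asum_le => [||ab]; first exact: tp_mul_term_null.
  by rewrite ltr_wpDl // mulr_ge0 ?gauss_norm_ge0.
by apply: le_trans (term_le d ab) _; rewrite lerDl ltW.
Qed.

Lemma gauss_normM f g : gauss_norm (f * g) = gauss_norm f * gauss_norm g.
Proof.
have [->|/leading_exists[a fa]] := eqVneq f 0.
  by rewrite !mul0r gauss_norm0 mul0r.
have [->|/leading_exists[b gb]] := eqVneq g 0.
  by rewrite !mulr0 gauss_norm0 mulr0.
apply/le_anti; rewrite gauss_normM_le /= (gauss_norm_leading fa).
by rewrite (gauss_norm_leading gb) -vabs_leadingM // gauss_norm_ge.
Qed.

Lemma gauss_normX f k : gauss_norm (f ^+ k) = gauss_norm f ^+ k.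
Proof.
by elim: k => [|k IHk]; rewrite ?expr0 ?gauss_norm1 // !exprS gauss_normM IHk.
Qed.

Lemma power_boundedP f : power_bounded f <-> gauss_norm f <= 1.
Proof.
split=> [[C hC]|f1].
  by apply: (@expr_bounded_le1 _ _ C) => k; rewrite -gauss_normX.
by exists 1 => k; rewrite gauss_normX exprn_ile1 ?gauss_norm_ge0.
Qed.

(** * Completeness and the geometric series *)

(** The sum is formed coefficientwise; it is again a null family because all but
    finitely many terms are uniformly small. *)
Lemma gauss_summable (u : nat -> T) :
  (forall e, 0 < e -> exists N, forall k, (N <= k)%N -> gauss_norm (u k) < e) ->
  exists s : T, forall e, 0 < e -> exists N,
    forall m, (N <= m)%N -> gauss_norm (s - \sum_(k < m) u k) <= e.
Proof.
move=> u_small.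
have nu a : null_family (fun k => u k a).
  move=> e /u_small[N hN]; apply: sub_finite_set (finite_II N) => k /= ek.
  rewrite ltnNge; apply/negP => /hN; rewrite ltNge.
  by rewrite (le_trans ek) // gauss_norm_ge.
have ns : null_family (fun a => asum (fun k => u k a)).
  move=> e e0; have e20 : 0 < e / 2 by rewrite divr_gt0.
  have e2e : e / 2 < e by rewrite ltr_pdivrMr // ltr_pMr // ltr1n.
  have [N hN] := u_small _ e20.
  apply: (@sub_finite_set _ _
    (\bigcup_(k in `I_N) [set a | e / 2 <= vabs (u k a)])%classic); last first.
    by apply: bigcup_finite (finite_II N) _ => k _; apply: (coef_null (u k)).
  move=> a /= ea; apply: contra_leP ea => na.
  apply: le_lt_trans e2e; apply: asum_le => // k.
  have [/hN/ltW|kN] := leqP N k; first by apply: le_trans; exact: gauss_norm_ge.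
  by rewrite leNgt; apply/negP => /ltW h; apply: na; exists k.
exists (TatePerf ns) => e e0; have [N hN] := u_small e e0; exists N => m Nm.
apply/gauss_norm_leP => a; rewrite tpDE tpNE tp_sumE /=.
have -> : \sum_(k < m) u k a = \sum_(k <- [fset k in iota 0 m]%fset) u k a.
  rewrite -(big_mkord xpredT (fun k => u k a)) /index_iota subn0.
  apply: perm_big; apply: uniq_perm; rewrite ?iota_uniq ?fset_uniq // => k.
  by rewrite inE.
apply: asum_approx => // k; rewrite inE mem_iota /= add0n -leqNgt.
move=> /(leq_trans Nm)/hN/ltW.
by apply: le_trans; exact: gauss_norm_ge.
Qed.

Lemma geometric_inverse h : gauss_norm h < 1 -> exists g, (1 - h) * g = 1.
Proof.
move=> h1.
have hX_small e : 0 < e ->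
    exists N, forall k, (N <= k)%N -> gauss_norm (h ^+ k) < e.
  have h01 : 0 <= gauss_norm h < 1 by rewrite gauss_norm_ge0.
  by move=> /(expr_small h01)[N hN]; exists N => k /hN; rewrite gauss_normX.
have [s hs] := gauss_summable hX_small.
exists s; apply/subr0_eq/gauss_norm_small => e e0.
have [N1 hN1] := hs e e0; have [N2 hN2] := hX_small e e0.
pose m := maxn N1 N2.
have -> : (1 - h) * s - 1 = (1 - h) * (s - \sum_(k < m) h ^+ k) - h ^+ m.
  have hm : (1 - h) * \sum_(k < m) h ^+ k = 1 - h ^+ m.
    by apply: oppr_inj; rewrite -mulNr !opprB subrX1.
  by rewrite mulrBr hm -addrA -opprD subrK.
apply: gauss_normD_le; last by rewrite gauss_normN ltW // hN2 ?leq_maxr.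
rewrite gauss_normM -[e]mul1r; apply: ler_pM; rewrite ?gauss_norm_ge0 //.
  by apply: gauss_normD_le; rewrite ?gauss_norm1 // gauss_normN ltW.
by apply: hN1; rewrite leq_maxl.
Qed.

(** * Units of the ring of power-bounded elements *)

Lemma tp_const_null (c : K) :
  null_family (fun a : E => if a == 0 then c else 0).
Proof.
move=> e e0; apply: (@sub_finite_set _ _ [set 0]%classic) => // a /=.
by case: eqP => // _; rewrite vabs0 leNgt e0.
Qed.
Definition tp_const (c : K) : T := TatePerf (tp_const_null c).

Lemma tp_constME (c : K) f a : (tp_const c * f) a = c * f a.
Proof.
rewrite tpME (@asum_single _ _ _ _ (0, a)).
  by rewrite /tp_mul_term /= add0r !eqxx.
move=> [b d]; rewrite xpair_eqE /tp_mul_term /=.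
case: (eqVneq b 0) => [->|_] /=; last by rewrite mul0r if_same.
by rewrite add0r => /negPf->.
Qed.

(** After scaling, [f] is [1 - h] with all coefficients of [h] less than one;
    they form a null family, so even the Gauss norm of [h] is less than one. *)
Lemma inverse_dominant f : vabs (f 0) = 1 ->
  (forall a, a != 0 -> vabs (f a) < 1) -> exists g, f * g = 1.
Proof.
move=> f0 fa.
have f0_neq0 : f 0 != 0 by rewrite -vabs_gt0 f0.
pose u := tp_const (f 0)^-1; pose h := 1 - u * f.
have hE a : h a = if a == 0 then 0 else - ((f 0)^-1 * f a).
  rewrite tpDE tpNE tp1E tp_constME; case: eqP => [->|_]; last by rewrite sub0r.
  by rewrite mulVf // subrr.
have h_lt1 a : vabs (h a) < 1.
  rewrite hE; case: eqP => [_|/eqP/fa a1]; first by rewrite vabs0.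
  have <- : vabs (f 0)^-1 = 1.
    by rewrite -[LHS]mulr1 -f0 -vabsM mulVf // vabs1 f0.
  by rewrite vabsN vabsM gtr_pMr // vabs_gt0 invr_neq0.
have [e /andP[_ e1] he] :=
  @null_family_gap _ _ _ _ xpredT _ (coef_null h) ltr01 (fun a _ => h_lt1 a).
have [|g hg] := @geometric_inverse h.
  by apply: le_lt_trans e1; apply/gauss_norm_leP => a; exact: he.
by exists (u * g); rewrite -hg subKr mulrCA mulrA.
Qed.

Lemma power_bounded_unit_norm f : power_bounded_unit f -> gauss_norm f = 1.
Proof.
case=> /power_boundedP f1 [g /power_boundedP g1 fg].
apply/le_anti; rewrite f1 -gauss_norm1 -fg gauss_normM.
by rewrite ler_piMr ?gauss_norm_ge0.
Qed.

(** The leading exponents of [f] and of its inverse add up to an exponent of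
    [1], that is to zero, so both vanish: zero is the lexicographically last
    exponent at which [f] attains its norm. *)
Lemma leading_inverse f g : f * g = 1 -> leading f 0.
Proof.
move=> fg.
have f0 : f != 0.
  by apply: contra_eq_neq fg => ->; rewrite mul0r eq_sym oner_neq0.
have g0 : g != 0.
  by apply: contra_eq_neq fg => ->; rewrite mulr0 eq_sym oner_neq0.
have [[a fa] [b gb]] := (leading_exists f0, leading_exists g0).
have := vabs_leadingM fa gb; rewrite fg tp1E.
have [/expo_add_eq0 a0 _|_ /eqP] := eqVneq (a + b) 0; first by rewrite a0 in fa.
case: fa gb => [/negPf fa _ _] [/negPf gb _ _].
by rewrite vabs0 eq_sym mulf_eq0 !vabs_eq0 fa gb.
Qed.

End GaussNorm.

Theorem corollary2p6 (R : realType) (p n : nat) (K : perfectoidFieldType R p)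
    (f : tate_perf p n K) :
  (1 <= n)%N -> power_bounded f ->
  (power_bounded_unit f <->
   vabs (f 0) = 1 /\ forall a : expo p n, a != 0 -> vabs (f a) < 1).
Proof.
move=> _ f_bd; split=> [f_unit|[f0 fa]].
  have [_ [g _ fg]] := f_unit.
  have lead_f := leading_inverse fg.
  rewrite -(power_bounded_unit_norm f_unit) (gauss_norm_leading lead_f).
  by case: lead_f => _ _ flt; split=> // a /lexlt_gt0/flt.
have [g fg] := inverse_dominant f0 fa.
split; [exact: f_bd|exists g; last exact: fg].
have f1 : gauss_norm f = 1.
  rewrite -f0; apply: gauss_norm_max => a; rewrite f0.
  by have [->|/fa/ltW//] := eqVneq a 0; rewrite f0.
apply/power_boundedP.
by rewrite -(@gauss_norm1 R p n K) -fg gauss_normM f1 mul1r.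
Qed.
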